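(* Let $f,g\colon\mathbb{R}\to\mathbb{R}$ be functions satisfying $$g(x+y)-g(x)-g(y)\geq xf(y)+yf(x)\qquad\text{for all } x,y\in\mathbb{R}.$$ If $f$ is odd and $f(2x)=2f(x)$ for each $x\in\mathbb{R}$, then $f$ is additive and there exists a subadditive mapping $A\colon\mathbb{R}\to\mathbb{R}$ such that $$g(x)=xf(x)-A(x)\qquad\text{for all } x\in\mathbb{R}.$$
   Context: A function $h\colon\mathbb{R}\to\mathbb{R}$ is additive if $h(x+y)=h(x)+h(y)$ for all $x,y\in\mathbb{R}$, subadditive if $h(x+y)\le h(x)+h(y)$ for all $x,y\in\mathbb{R}$, and odd if $h(-x)=-h(x)$ for all $x\in\mathbb{R}$. *)

(* Defs.v *)
From Stdlib Require Import Reals.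
Local Open Scope R_scope.

Definition additive (h : R -> R) : Prop :=
  forall x y : R, h (x + y) = h x + h y.

Definition subadditive (h : R -> R) : Prop :=
  forall x y : R, h (x + y) <= h x + h y.

Definition odd_function (h : R -> R) : Prop :=
  forall x : R, h (- x) = - h x.

(* Main.v *)
Require Import Defs.
From Stdlib Require Import Reals Lra.
Local Open Scope R_scope.

(** Put [A x = x f(x) - g(x)] and [D x y = f(x+y) - f(x) - f(y)].  The hypothesis
    reads [A(x+y) <= A x + A y + (x+y) D x y].  It gives [A(2x) <= 2 A x] and
    [0 <= A x + A(-x)], so [A(2^n x)] grows at most like [2^n] in both directions,
    whereas [(x+y) D x y] is multiplied by [4^n] when [x, y] are replaced by
    [2^n x, 2^n y]; hence [0 <= (x+y) D x y].  For [x + y + z = 0] and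
    [S = f x + f y + f z] this says [0 <= z S], and by symmetry [0 <= x S] and
    [0 <= y S].  These three numbers sum to zero, so they all vanish and [S = 0]. *)

Lemma nonneg_of_affine_pow2 (K t : R) :
  (forall n : nat, 0 <= K + t * 2 ^ n) -> 0 <= t.
Proof.
  intros H.
  destruct (Rle_or_lt 0 t) as [Ht | Ht]; [exact Ht | exfalso].
  (* The summand [1] makes [- t * 2 ^ N] at least [K - t], which exceeds [K] because [t < 0]. *)
  destruct (Pow_x_infinity 2 ltac:(rewrite Rabs_pos_eq; lra) (K / - t + 1))
    as [N HN].
  specialize (HN N (le_n N)).
  rewrite Rabs_pos_eq in HN by (apply pow_le; lra).
  specialize (H N).
  assert (E : - t * (K / - t + 1) = K - t) by (field; lra).
  pose proof (Rmult_le_compat_l (- t) _ _ ltac:(lra) (Rge_le _ _ HN)).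
  lra.
Qed.

Lemma doubling_pow2 (h : R -> R) (hdouble : forall x, h (2 * x) = 2 * h x)
  (n : nat) (x : R) : h (2 ^ n * x) = 2 ^ n * h x.
Proof.
  induction n as [| n IH]; simpl.
  - now rewrite !Rmult_1_l.
  - now rewrite !Rmult_assoc, hdouble, IH.
Qed.

Lemma subdoubling_pow2 (h : R -> R) (hdouble : forall x, h (2 * x) <= 2 * h x)
  (n : nat) (x : R) : h (2 ^ n * x) <= 2 ^ n * h x.
Proof.
  induction n as [| n IH]; simpl.
  - rewrite !Rmult_1_l; lra.
  - rewrite !Rmult_assoc.
    pose proof (hdouble (2 ^ n * x)); lra.
Qed.

Lemma additive_defect_nonneg (f A : R -> R)
  (hA : forall x y, A (x + y) <= A x + A y + (x + y) * (f (x + y) - f x - f y))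
  (hdouble : forall x, f (2 * x) = 2 * f x) (x y : R) :
  0 <= (x + y) * (f (x + y) - f x - f y).
Proof.
  assert (A0 : 0 <= A 0).
  { pose proof (hA 0 0) as H; rewrite Rplus_0_r in H; lra. }
  assert (Asym : forall u, 0 <= A u + A (- u)).
  { intros u; pose proof (hA u (- u)) as H.
    rewrite Rplus_opp_r in H; lra. }
  assert (A2 : forall u, A (2 * u) <= 2 * A u).
  { intros u; pose proof (hA u u) as H.
    replace (u + u) with (2 * u) in H by ring.
    rewrite hdouble in H.
    replace (2 * u * (2 * f u - f u - f u)) with 0 in H by ring.
    lra. }
  (* The constant collects the terms of order [2 ^ n]; after division by [2 ^ n] the defect term
     keeps one factor [2 ^ n]. *)
  apply (nonneg_of_affine_pow2 (A x + A y + A (- (x + y)))); intros n.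
  pose proof (hA (2 ^ n * x) (2 ^ n * y)) as H.
  rewrite <- Rmult_plus_distr_l, !(doubling_pow2 f hdouble) in H.
  (* [A] is bounded below here by way of its upper bound at the opposite point. *)
  pose proof (Asym (2 ^ n * (x + y))) as Hs.
  rewrite Ropp_mult_distr_r in Hs.
  pose proof (subdoubling_pow2 A A2 n x).
  pose proof (subdoubling_pow2 A A2 n y).
  pose proof (subdoubling_pow2 A A2 n (- (x + y))).
  apply Rmult_le_reg_l with (2 ^ n); [apply pow_lt; lra |].
  lra.
Qed.

Lemma additive_of_defect_nonneg (f : R -> R) (hodd : odd_function f)
  (hD : forall x y, 0 <= (x + y) * (f (x + y) - f x - f y)) : additive f.
Proof.
  assert (f0 : f 0 = 0).
  { pose proof (hodd 0) as H; rewrite Ropp_0 in H; lra. }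
  assert (hS : forall x y z, x + y + z = 0 -> 0 <= z * (f x + f y + f z)).
  { intros x y z Hz.
    replace z with (- (x + y)) by lra.
    rewrite hodd.
    pose proof (hD x y); lra. }
  intros x y.
  pose proof (hS x y (- (x + y)) ltac:(ring)) as Hz.
  pose proof (hS (- (x + y)) x y ltac:(ring)) as Hy.
  pose proof (hS y (- (x + y)) x ltac:(ring)) as Hx.
  rewrite hodd in Hx, Hy, Hz.
  assert (Ex : x * (f (x + y) - f x - f y) = 0) by lra.
  assert (Ey : y * (f (x + y) - f x - f y) = 0) by lra.
  (* Either [x = 0], where [f 0 = 0] suffices, or the defect vanishes. *)
  destruct (Rmult_integral _ _ Ex) as [-> |]; [| lra].
  rewrite Rplus_0_l, f0; ring.
Qed.

Theorem theorem4p1 (f g : R -> R)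
  (hfg : forall x y : R, g (x + y) - g x - g y >= x * f y + y * f x)
  (hodd : odd_function f)
  (hdouble : forall x : R, f (2 * x) = 2 * f x) :
  additive f /\
  exists A : R -> R, subadditive A /\ forall x : R, g x = x * f x - A x.
Proof.
  (* This rests on [x f(y) + y f(x) = (x + y) (f(x) + f(y)) - x f(x) - y f(y)]. *)
  assert (hA : forall x y,
    (x + y) * f (x + y) - g (x + y) <=
    (x * f x - g x) + (y * f y - g y) + (x + y) * (f (x + y) - f x - f y)).
  { intros x y; pose proof (hfg x y); lra. }
  assert (hadd : additive f).
  { apply (additive_of_defect_nonneg f hodd).
    exact (additive_defect_nonneg f (fun x => x * f x - g x) hA hdouble). }
  split; [exact hadd |].
  exists (fun x => x * f x - g x); split.
  - intros x y; pose proof (hA x y) as H.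
    rewrite (hadd x y) in H |- *; lra.
  - intros x; ring.
Qed.
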